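(* Consider a class $\mathbb M$ Markov chain (as defined in the context) with $\lambda_m,\mu_m>0$ for all $0\le m\le M$ and with $r_0=r_1=\cdots=r_M$. Let $\pi$ denote its limiting probability distribution. Then there are real constants $\{c_{m,k}\}_{0\le k\le m\le M}$ such that for all $0\le m\le M$ and $j\ge j_0$, $$\pi_{(m,j)}=\sum_{k=0}^{m}c_{m,k}\binom{j-(j_0+1)+k}{k}r_0^{\,j-j_0},$$ where the values $\{c_{m,k}\}_{0\le k\le m\le M}$ satisfy the following system of linear equations: (1) for $0\le m\le M$: $\;c_{m,0}=\pi_{(m,j_0)}$; (2) for $1\le k\le m-1$, $m\le M$: $$c_{m,k}=\Omega_m r_0\sum_{u=k}^{m-1}\sum_{i=u}^{m-1}c_{i,u}\left[\sum_{\Delta=-1}^{1}\frac{\alpha_i\langle m-i;\Delta\rangle\,\phi_m(\alpha_m)^{\Delta+1}}{(1-r_0\phi_m(\alpha_m))^{u+1-k}}\right]-\frac1{\lambda_m}\sum_{i=k}^{m-1}c_{i,k}\,\alpha_i\langle m-i;1\rangle+\Omega_m\sum_{i=k-1}^{m-1}c_{i,k-1}\left[\sum_{\Delta=-1}^{1}\alpha_i\langle m-i;\Delta\rangle\, r_0^{-\Delta}\right];$$ (3) for $1\le m\le M$: $$c_{m,m}=c_{m-1,m-1}\,\Omega_m\sum_{\Delta=-1}^{1}\alpha_{m-1}\langle 1;\Delta\rangle\, r_0^{-\Delta};$$ together with the usual balance equations of the chain for the states in $\mathcal N$ and the states $(m,j_0)$, $0\le m\le M$ (that is, $\pi_x\sum_{y\ne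 x}q(x,y)=\sum_{y\neq x}\pi_y q(y,x)$), and the normalization constraint $\sum_{x\in\mathcal E}\pi_x=1$.
   Context: A class $\mathbb M$ Markov chain is an ergodic (irreducible, positive recurrent) continuous-time Markov chain with transition rates $q(x,y)\ge 0$ for $x\ne y$ and the following structure. The state space is a disjoint union $\mathcal E=\mathcal R\cup\mathcal N$, where $\mathcal N$ is finite and $\mathcal R=\{(m,j): 0\le m\le M,\ j\ge j_0\}$ with $M,j_0$ finite nonnegative integers; a state $(m,j)\in\mathcal R$ is said to be in phase $m$ and level $j$, and $L_j=\{(0,j),\ldots,(M,j)\}$. Transitions within $\mathcal N$ may have any rates; transitions from $\mathcal N$ to $\mathcal R$ may only enter $L_{j_0}$ (any rates); transitions from $\mathcal R$ to $\mathcal N$ may only leave from $L_{j_0}$ (any rates). The transitions within $\mathcal R$ are exactly the following, with nonnegative rates not depending on the level $j$: - $q((m,j),(m,j+1))=\lambda_m$ for $0\le m\le M$, $j\ge j_0$; - $q((m,j),(m,j-1))=\mu_m$ for $0\le m\le M$, $j\ge j_0+1$; - $q((m,j),(i,j-1))=\alpha_m\langle i-m;-1\rangle$ for $0\le m<i\le M$, $j\ge j_0+1$; - $q((m,j),(i,j))=\alpha_m\langle i-m;0\rangle$ for $0\le m<i\le M$, $j\ge j_0$; - $q((m,j),(i,j+1))=\alpha_m\langle i-m;1\rangle$ for $0\le m<i\le M$, $j\ge j_0$. Set $\alpha_m=\sum_{i=m+1}^M\sum_{\Delta=-1}^{1}\alpha_m\langle i-m;\Delta\rangle$ (so $\alpha_M=0$).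 For $\lambda_m,\mu_m>0$ let $\rho_m=\lambda_m/\mu_m$, $$\phi_m(s)=\frac{s+\lambda_m+\mu_m-\sqrt{(s+\lambda_m+\mu_m)^2-4\lambda_m\mu_m}}{2\lambda_m}\quad(s\ge0),$$ $$r_m=\rho_m\phi_m(\alpha_m),\qquad \Omega_m=\frac{r_m}{\lambda_m(1-r_m\phi_m(\alpha_m))}.$$ $\pi_x$ denotes the limiting (stationary) probability of state $x$. Binomial coefficient convention at $j=j_0$: $\binom{-1}{0}=1$ and $\binom{k-1}{k}=0$ for $k\ge1$. *)

(* Defs.v *)
From HB Require Import structures.
From mathcomp Require Import all_boot all_order all_algebra.
From mathcomp Require Import all_classical all_reals all_analysis.
Set Implicit Arguments.
Unset Strict Implicit.
Unset Printing Implicit Defensive.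
Import Order.TTheory GRing.Theory Num.Theory numFieldNormedType.Exports.
Local Open Scope classical_set_scope.
Local Open Scope ring_scope.

Section continuous_time_chains.
Context {R : realType} {T : countType}.
Implicit Types (q : T -> T -> R) (pi : T -> R).

(* Only the off-diagonal entries of [q] are ever used. *)
Definition exit_rate q (x : T) : \bar R :=
  (\esum_(y in [set y | y != x]) (q x y)%:E)%E.

Definition balance_at q pi (x : T) : Prop :=
  ((pi x)%:E * exit_rate q x =
   \esum_(y in [set y | y != x]) (pi y * q y x)%:E)%E.

Context {d : measure_display} {W : measurableType d}.
(* [P x] is the law under which the process [X] starts from [x]; the values
   [X t] at negative times are irrelevant. *)
Implicit Types (P : T -> probability W R) (X : R -> W -> T).

Definition at_state X (t : R) (y : T) : set W := [set w | X t w = y].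

Definition history X (l : seq (R * T)) : set W :=
  [set w | forall u, u \in l -> X u.1 w = u.2].

Definition trans_prob P X (t : R) (x y : T) : R := fine (P x (at_state X t y)).

(* Time-homogeneous Markov chain with right-continuous paths (for the discrete
   topology on the state space) and stable, conservative transition rates [q]. *)
Record is_ctmc P X q : Prop := IsCTMC {
  ctmc_rate_ge0 : forall x y, x != y -> 0 <= q x y ;
  ctmc_measurable : forall t y, 0 <= t -> measurable (at_state X t y) ;
  ctmc_right_continuous : forall w t, 0 <= t ->
    \forall s \near t^'+, X s w = X t w ;
  ctmc_start : forall x, P x (at_state X 0 x) = 1%E ;
  ctmc_markov : forall x (l : seq (R * T)) (s t : R) (y z : T),
    0 <= t -> 0 <= s -> (forall u, u \in l -> 0 <= u.1 <= s) ->
    P x (history X l `&` at_state X s y `&` at_state X (s + t) z) =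
    (P x (history X l `&` at_state X s y) * P y (at_state X t z))%E ;
  ctmc_rate : forall x y, x != y ->
    (trans_prob P X t x y / t) @[t --> 0^'+] --> q x y ;
  ctmc_exit_rate : forall x,
    ((1 - trans_prob P X t x x) / t)%:E @[t --> 0^'+] --> exit_rate q x }.

Definition irreducible P X : Prop :=
  forall x y, exists2 t : R, 0 <= t & 0 < trans_prob P X t x y.

(* First time at which the process is in [x] after having left [x]; it is +oo
   when there is no such time. *)
Definition return_time X (x : T) (w : W) : \bar R :=
  ereal_inf [set t%:E | t in
    [set t : R | X t w = x /\ exists s : R, 0 <= s < t /\ X s w != x]].

Definition positive_recurrent P X : Prop :=
  forall x, (\int[P x]_w return_time X x w < +oo)%E.

Definition ergodic P X : Prop := irreducible P X /\ positive_recurrent P X.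

Definition prob_distribution pi : Prop :=
  (forall x, 0 <= pi x) /\ (\esum_(x in [set: T]) (pi x)%:E)%E = 1%E.

Definition limiting_distribution P X pi : Prop :=
  prob_distribution pi /\
  forall x y, trans_prob P X t x y @[t --> +oo] --> pi y.

End continuous_time_chains.

Definition level (j0 : nat) : Type := {j : nat | (j0 <= j)%N}.
HB.instance Definition _ (j0 : nat) := Countable.on (level j0).

Definition base_level (j0 : nat) : level j0 := exist _ j0 (leqnn j0).

(* [inl n] is the state [n] of the finite part, [inr (m, j)] is phase [m] of
   level [j]. *)
Definition state (N : finType) (M j0 : nat) : Type :=
  (N + 'I_M.+1 * level j0)%type.
HB.instance Definition _ (N : finType) (M j0 : nat) :=
  Countable.on (state N M j0).

Definition in_N {N : finType} {M j0 : nat} (n : N) : state N M j0 := inl n.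
Definition in_R {N : finType} {M j0 : nat} (m : 'I_M.+1) (j : level j0) :
  state N M j0 := inr (m, j).

Definition level_steps : seq int := [:: -1; 0; 1].

Section classM.
Context {R : realType}.
(* [alpha m a D] stands for alpha_m<a; D>: the rate out of phase [m] of a jump
   that raises the phase by [a] and changes the level by [D]. *)
Implicit Types (lambda mu : nat -> R) (alpha : nat -> nat -> int -> R).

Definition phase_rate lambda mu alpha (m j i l : nat) : R :=
  let D := l%:Z - j%:Z in
  if i == m then
    if D == 1 then lambda m else if D == -1 then mu m else 0
  else if (m < i)%N && (D \in level_steps) then alpha m (i - m)%N D
  else 0.

Record classM (N : finType) (M j0 : nat) lambda mu alpha
    (q : state N M j0 -> state N M j0 -> R) : Prop := ClassM {
  classM_rate_ge0 : forall x y, x != y -> 0 <= q x y ;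
  classM_lambda_ge0 : forall m, (m <= M)%N -> 0 <= lambda m ;
  classM_mu_ge0 : forall m, (m <= M)%N -> 0 <= mu m ;
  classM_alpha_ge0 : forall m i D, (m < i <= M)%N -> D \in level_steps ->
    0 <= alpha m (i - m)%N D ;
  classM_enter : forall n m j, j != base_level j0 -> q (in_N n) (in_R m j) = 0 ;
  classM_leave : forall n m j, j != base_level j0 -> q (in_R m j) (in_N n) = 0 ;
  classM_within : forall (m i : 'I_M.+1) (j l : level j0),
    in_R m j != in_R i l :> state N M j0 ->
    q (in_R m j) (in_R i l) = phase_rate lambda mu alpha m (val j) i (val l) }.

Definition alpha_tot (M : nat) alpha (m : nat) : R :=
  \sum_(m.+1 <= i < M.+1) \sum_(D <- level_steps) alpha m (i - m)%N D.

Definition phi lambda mu (m : nat) (s : R) : R :=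
  (s + lambda m + mu m
   - Num.sqrt ((s + lambda m + mu m) ^+ 2 - 4 * lambda m * mu m))
  / (2 * lambda m).

(* phi_m(alpha_m) *)
Definition phia (M : nat) lambda mu alpha (m : nat) : R :=
  phi lambda mu m (alpha_tot M alpha m).

Definition rbase (M : nat) lambda mu alpha (m : nat) : R :=
  lambda m / mu m * phia M lambda mu alpha m.

Definition Omega (M : nat) lambda mu alpha (m : nat) : R :=
  rbase M lambda mu alpha m
  / (lambda m * (1 - rbase M lambda mu alpha m * phia M lambda mu alpha m)).

End classM.

(* The binomial coefficient (j - (j0 + 1) + k choose k) for j >= j0.  The
   truncated subtraction is performed last, which gives the conventions
   (-1 choose 0) = 1 and (k - 1 choose k) = 0 for k >= 1 when j = j0. *)
Definition level_bin (j0 j k : nat) : nat := 'C(j + k - j0.+1, k).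

(* Main.v *)
Require Import Defs.
From HB Require Import structures.
From mathcomp Require Import all_boot all_order all_algebra.
From mathcomp Require Import all_classical all_reals all_analysis.
From mathcomp Require Import finmap ring lra zify.
Set Implicit Arguments.
Unset Strict Implicit.
Unset Printing Implicit Defensive.
Import Order.TTheory GRing.Theory Num.Theory numFieldNormedType.Exports.
Local Open Scope classical_set_scope.
Local Open Scope ring_scope.

(** The law [pi] is shown to satisfy every balance equation of the chain; on
    the levels above the base these are, phase by phase, second-order linear
    recurrences with constant coefficients, which are then solved in closed form.

    _Balance._ Letting the time of the first factor tend to infinity in the
    Chapman-Kolmogorov equation, restricted to finitely many intermediate
    states, shows that [pi] is subinvariant ([limiting_subinvariant]); dividing
    by a small time, the flow of [pi] into a state is at most the flow out of it
    ([inflow_le_outflow]). Summed over all states, both flows amount to the same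
    total, finite because the exit rates of a class M chain are bounded
    ([exit_rate_bounded]), so each inequality is an equality
    ([limiting_balance]). Irreducibility makes [pi] positive everywhere.

    _The recurrence of a phase._ Write [x m n] for the probability of phase [m]
    at level [j0 + n]. Balance above the base level reads
    [(la + mu + alpha) x m n.+1 = la x m n + mu x m n.+2 + f n], where [f n]
    involves only the phases below [m] ([phase_recurrence]). As [phi] is a root
    of [la z^2 - (la + mu + alpha) z + mu], the homogeneous recurrence has the
    characteristic roots [r] and [1 / phi >= 1]. For the top phase [f] is
    nonnegative and [alpha] vanishes, and a supersolution that decays cannot be
    positive when [mu <= la]; hence [r < 1] for that phase
    ([rbase_top_lt1]), and then for all of them since they share [r].

    _Solving it._ By induction on [m], [f] is a combination of the sequences
    [B k n = 'C(n + k - 1, k) r^n] ([negbin]). Moving such a combination one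
    level down acts on its coefficients [a k] through the differences
    [a k - a k.+1] ([negbin_comb_back]); this turns the recurrence into
    identities between coefficients, which the formula for [c m k] satisfies
    ([particular_solution]). Both [x m] and this solution tend to zero and agree
    at [n = 0]; their difference solves the homogeneous recurrence, and a
    decaying solution has no component along [(1 / phi)^n], so it is a multiple
    of [r^n], here zero ([decaying_solution0]). *)

(** * Sums over countable sets *)

Lemma esum_exchange (R : realType) (T1 T2 : choiceType) (I : set T1)
    (J : T1 -> set T2) (I' : T2 -> set T1) (J' : set T2) (a : T1 -> T2 -> \bar R) :
  (forall i j, (I i /\ J i j) <-> (J' j /\ I' j i)) ->
  (forall i j, I i -> J i j -> (0 <= a i j)%E) ->
  (\esum_(i in I) \esum_(j in J i) a i j =
   \esum_(j in J') \esum_(i in I' j) a i j)%E.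
Proof.
move=> IJ a0; rewrite !esum_esum//; last first.
  by move=> j i J'j I'ji; have [_ /(_ (conj J'j I'ji))[]] := IJ i j; exact: a0.
rewrite (reindex_esum (J' `*`` I') _ (fun k => (k.2, k.1)))//; split.
- by move=> [j i] [/= J'j I'ji]; apply/IJ.
- by move=> [j1 i1] [j2 i2] _ _ /= [-> ->].
- by move=> [i j] /IJ[/= J'j I'ji]; exists (j, i).
Qed.

Lemma esumZl (R : realType) (T : choiceType) (D : set T) (c : R) (f : T -> R) :
  0 <= c ->
  (\esum_(x in D) (c * f x)%:E = c%:E * \esum_(x in D) (f x)%:E)%E.
Proof.
rewrite le_eqVlt => /predU1P[<-|c0].
  by rewrite mul0e esum1// => x _; rewrite mul0r.
have sumE (A : set T) : finite_set A ->
    (\sum_(x \in A) (c * f x)%:E = c%:E * \sum_(x \in A) (f x)%:E)%E.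
  by move=> finA; rewrite !fsbig_finite// !sumEFin -EFinM mulr_sumr.
apply/eqP; rewrite eq_le; apply/andP; split.
  apply: ge_ereal_sup => _ [A [finA AD] <-].
  by rewrite sumE// lee_pmul2l// esum_ge//; exists A.
rewrite -lee_pdivlMl//; apply: ge_ereal_sup => _ [A [finA AD] <-].
by rewrite lee_pdivlMl// -sumE// esum_ge//; exists A.
Qed.

(** Finiteness is needed to cancel the sums over the other indices. *)
Lemma esum_le_eq (R : realType) (T : choiceType) (a b : T -> \bar R) :
  (forall x, 0 <= b x <= a x)%E ->
  (\esum_(x in [set: T]) a x <= \esum_(x in [set: T]) b x)%E ->
  (\esum_(x in [set: T]) a x < +oo)%E ->
  forall x, a x = b x.
Proof.
move=> ba; have b0 x : (0 <= b x)%E by case/andP: (ba x).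
have a0 x : (0 <= a x)%E by case/andP: (ba x); exact: le_trans.
move=> ab afin x; apply/eqP; rewrite eq_le andbC; apply/andP; split.
  by case/andP: (ba x).
move: ab afin; rewrite (esumID [set x])//= [X in (_ <= X)%E -> _](esumID [set x])//.
rewrite setTI !esum_set1//; set A := esum _ a; set B := esum _ b => ab afin.
have A0 : (0 <= A)%E by exact: esum_ge0.
have Afin : A \is a fin_num.
  by rewrite ge0_fin_numE//; apply: le_lt_trans afin; exact: leeDr.
rewrite -(leeD2rE _ _ Afin) (le_trans ab)// leeD2l//.
by apply: le_esum => y _; case/andP: (ba y).
Qed.

Lemma esum_support (R : realType) (T : choiceType) (D : set T) (f : T -> R)
    (s : seq T) : uniq s -> (forall y, D y -> 0 <= f y) ->
  (forall y, D y -> y \notin s -> f y = 0) ->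
  (forall y, y \in s -> ~ D y -> f y = 0) ->
  (\esum_(y in D) (f y)%:E = (\sum_(y <- s) f y)%:E)%E.
Proof.
move=> us f0 fD fs; rewrite esum_mkcond.
rewrite (eq_esum (b := fun y => if y \in [set` s] then (f y)%:E else 0%E)).
  rewrite -esum_mkcond.
  rewrite esum_fset//; last first.
    move=> y /set_mem/= ys; rewrite lee_fin.
    by have [/f0//|/(fs _ ys) ->] := pselect (D y).
  by rewrite -fsbig_seq// sumEFin.
move=> y _; case: ifPn => [/set_mem Dy|/negP yD]; case: ifPn => //.
  by rewrite notin_setE/= => /negP; move/(fD _ Dy) ->.
move=> /set_mem/= ys; rewrite fs// => Dy; apply: yD; exact: mem_set.
Qed.

Lemma summable_cvg0 (R : realType) (T : choiceType) (f : T -> R) (e : nat -> T) :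
  (forall y, 0 <= f y) -> injective e ->
  (\esum_(y in [set: T]) (f y)%:E < +oo)%E ->
  f (e n) @[n --> \oo] --> 0.
Proof.
move=> f0 inje fin; apply: cvg_series_cvg_0.
apply: nondecreasing_is_cvgn.
  by apply/nondecreasing_seqP => n; rewrite /series/= big_nat_recr//= lerDl.
exists (fine (\esum_(y in [set: T]) (f y)%:E)%E) => _ [n _ <-].
rewrite -lee_fin fineK; last first.
  by rewrite ge0_fin_numE//; apply: esum_ge0 => y _; rewrite lee_fin.
rewrite /series/=; apply: esum_ge; exists [set` map e (iota 0 n)].
  by split => //; exact: finite_seq.
by rewrite -fsbig_seq ?map_inj_uniq ?iota_uniq// big_map sumEFin /index_iota subn0.
Qed.

(** * Balance equations for limiting distributions *)

Section stationarity.
Context {R : realType} {T : countType} {d : measure_display}.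
Context {W : measurableType d} (P : T -> probability W R) (X : R -> W -> T).
Context (q : T -> T -> R) (pi : T -> R).
Context (hX : is_ctmc P X q) (hpi : limiting_distribution P X pi).

Let p := trans_prob P X.

Let pE t x y : 0 <= t -> (p t x y)%:E = P x (at_state X t y).
Proof.
move=> t0; rewrite fineK// fin_num_measure//.
exact: (ctmc_measurable hX).
Qed.

(** Restricting the intermediate state to a finite set only loses mass; this
    half of Chapman-Kolmogorov passes to the limit without any domination. *)
Lemma chapman_kolmogorov_le (F : {fset T}) x y (u t : R) : 0 <= u -> 0 <= t ->
  \sum_(z <- F) p u x z * p t z y <= p (u + t) x y.
Proof.
move=> u0 t0; have ut0 : 0 <= u + t by exact: addr_ge0.
have mX := ctmc_measurable hX.
rewrite -lee_fin -sumEFin pE//.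
rewrite (eq_bigr (fun z => P x (at_state X u z `&` at_state X (u + t) y))).
  rewrite -measure_fbigsetU.
  - apply: le_measure; last 1 first.
    + by elim/big_ind : _ => // A B Ay By; rewrite subUset.
    + apply: mem_set; apply: bigsetU_measurable => z _.
      by apply: measurableI; exact: mX.
    + by apply: mem_set; exact: mX.
  - by move=> z _; apply: measurableI; exact: mX.
  - by move=> z1 z2 _ _ [w [[+ _] [+ _]]]; rewrite /at_state/= => -> ->.
move=> z _; rewrite EFinM !pE//.
have := @ctmc_markov _ _ _ _ _ _ _ hX x [::] u t z y t0 u0.
rewrite (_ : history X [::] = setT); last by apply/seteqP; split.
by rewrite !setTI => -> // v; rewrite in_nil.
Qed.

Lemma limiting_subinvariant (F : {fset T}) y (t : R) : 0 <= t ->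
  \sum_(z <- F) pi z * p t z y <= pi y.
Proof.
move=> t0; have [_ cvgp] := hpi.
have cF : \sum_(z <- F) p u y z * p t z y @[u --> +oo] -->
    \sum_(z <- F) pi z * p t z y.
  apply: cvg_big => [|z _]; first exact: add_continuous.
  by apply: cvgM; [exact: cvgp|exact: cvg_cst].
have cy : p (u + t) y y @[u --> +oo] --> pi y.
  by have := cvgp y y; have := cvg_addrr t; exact: cvg_comp.
apply: (ler_cvg_to cF cy); near=> u; apply: chapman_kolmogorov_le => //.
Unshelve. all: by end_near. Qed.

Let pi_ge0 x : 0 <= pi x.
Proof. by have [[]] := hpi. Qed.

(** Some state carries mass, and by subinvariance it sends a positive part of
    it to every state that it reaches. *)
Lemma limiting_gt0 : irreducible P X -> forall y, 0 < pi y.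
Proof.
move=> irr y; have [z piz] : exists z, 0 < pi z.
  apply: contrapT => /forallNP pi0; have [[_]] := hpi.
  rewrite esum1 => [/esym/eqP|z _]; first by rewrite onee_eq0.
  congr EFin; apply/eqP; rewrite eq_le pi_ge0 andbT leNgt.
  by apply/negP; exact: pi0.
have [t t0 pzy] := irr z y.
have := limiting_subinvariant [fset z]%fset y t0.
by rewrite big_seq_fset1; apply: lt_le_trans; exact: mulr_gt0.
Qed.

Let q_ge0 x y : x != y -> 0 <= q x y.
Proof. exact: (ctmc_rate_ge0 hX). Qed.

Lemma exit_rate_ge0 x : (0 <= exit_rate q x)%E.
Proof.
by apply: esum_ge0 => y /= yx; rewrite lee_fin q_ge0// eq_sym.
Qed.

(** Isolate the term of [y] in the subinvariance inequality over [y |` F],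
    divide by the time, and let it tend to zero. *)
Lemma inflow_le_outflow y : (exit_rate q y < +oo)%E ->
  (\esum_(z in [set z | z != y]) (pi z * q z y)%:E <= (pi y)%:E * exit_rate q y)%E.
Proof.
move=> fin_exit; apply: ge_ereal_sup => _ [A [finA Ay] <-].
rewrite fsbig_finite//= sumEFin.
have fE : exit_rate q y = (fine (exit_rate q y))%:E.
  by rewrite fineK// ge0_fin_numE// exit_rate_ge0.
rewrite fE -EFinM lee_fin; set F := fset_set A.
have yF z : z \in F -> z != y by rewrite in_fset_set// => /set_mem /Ay.
have cF : \sum_(z <- F) pi z * (p t z y / t) @[t --> 0^'+] -->
    \sum_(z <- F) pi z * q z y.
  rewrite big_seq; under eq_fun do rewrite big_seq.
  apply: cvg_big => [|z zF]; first exact: add_continuous.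
  by apply: cvgM; [exact: cvg_cst|exact: (ctmc_rate hX (yF _ zF))].
have cy : pi y * ((1 - p t y y) / t) @[t --> 0^'+] -->
    pi y * fine (exit_rate q y).
  apply: cvgM; first exact: cvg_cst.
  have /(_ y) := @ctmc_exit_rate _ _ _ _ _ _ _ hX.
  by rewrite [X in _ --> X -> _]fE => /fine_cvg.
apply: (ler_cvg_to cF cy); near=> t.
have t0 : 0 < t by near: t; exact: nbhs_right_gt.
have := limiting_subinvariant (y |` F)%fset y (ltW t0).
rewrite big_fsetU1/=; last by apply/negP => /yF; rewrite eqxx.
rewrite -lerBrDl -[X in _ <= X - _]mulr1 -mulrBr => le.
under eq_bigr do rewrite mulrA.
by rewrite -mulr_suml mulrA ler_pM2r ?invr_gt0.
Unshelve. all: by end_near. Qed.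

(** The bound on the rates makes the total flow finite, and by Tonelli the
    total inflow equals the total outflow: no inflow can be strictly smaller. *)
Lemma limiting_balance (K : R) : (forall x, exit_rate q x <= K%:E)%E ->
  forall x, balance_at q pi x.
Proof.
move=> exitK; have fin x : (exit_rate q x < +oo)%E.
  by apply: le_lt_trans (exitK x) _; rewrite ltry.
apply: esum_le_eq.
- move=> x; rewrite inflow_le_outflow// andbT; apply: esum_ge0 => z /= zx.
  by rewrite lee_fin mulr_ge0// q_ge0.
- rewrite (@esum_exchange _ _ _ _ _ (fun j => [set z | z != j]) setT)//; last 2 first.
  + by move=> i j; rewrite /= eq_sym; tauto.
  + by move=> i j _ /= ij; rewrite lee_fin mulr_ge0// q_ge0// eq_sym.
  by apply: le_esum => x _; rewrite -esumZl.
- apply: (@le_lt_trans _ _ (K%:E * 1)%E); last by rewrite mule1 ltry.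
  have [[_ <-] _] := hpi.
  have K0 (y : T) : 0 <= K by rewrite -lee_fin (le_trans (exit_rate_ge0 y)).
  have [[y _]|noT] := pselect (exists y : T, True); last first.
    by rewrite !esum1 ?mule0// => x; case: noT; exists x.
  rewrite -(esumZl _ _ (K0 y)); apply: le_esum => x _.
  by rewrite muleC EFinM lee_wpmul2r// lee_fin.
Qed.

End stationarity.

(** * Rates of class M chains *)

Section class_M_balance.
Context {R : realType} {N : finType} {M j0 : nat}.
Context (lambda mu : nat -> R) (alpha : nat -> nat -> int -> R).
Context (q : state N M j0 -> state N M j0 -> R).
Context (hM : classM lambda mu alpha q).

Definition level_at n : level j0 := exist _ (j0 + n)%N (leq_addr n j0).

Lemma level_atE (j : level j0) : j = level_at (val j - j0).
Proof. by apply: val_inj => /=; rewrite subnKC// (valP j). Qed.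

Lemma level_at_inj : injective level_at.
Proof. by move=> a b /(congr1 val)/= /addnI. Qed.

Lemma base_levelE : base_level j0 = level_at 0.
Proof. by apply: val_inj; rewrite /= addn0. Qed.

Definition phase_state (m : 'I_M.+1) n : state N M j0 := in_R m (level_at n).

Lemma phase_state_inj : injective (fun u : 'I_M.+1 * nat => phase_state u.1 u.2).
Proof. by move=> [m n] [i l] [-> /addnI ->]. Qed.

Lemma phase_state_enter k m n : q (in_N k) (phase_state m n.+1) = 0.
Proof.
by apply: (classM_enter hM); rewrite base_levelE (inj_eq level_at_inj).
Qed.

Lemma phase_state_leave k m n : q (phase_state m n.+1) (in_N k) = 0.
Proof.
by apply: (classM_leave hM); rewrite base_levelE (inj_eq level_at_inj).
Qed.

Local Notation rate_within m n i l :=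
  (phase_rate lambda mu alpha m (j0 + n) i (j0 + l)).

Lemma phase_state_within (m i : 'I_M.+1) n l : phase_state m n != phase_state i l ->
  q (phase_state m n) (phase_state i l) = rate_within m n i l.
Proof. exact: (classM_within hM). Qed.

Lemma phase_rate_up m i n : rate_within m n i n.+1 =
  if i == m then lambda m else if (m < i)%N then alpha m (i - m) 1 else 0.
Proof.
rewrite /phase_rate (_ : _ - _ = 1); last lia.
by rewrite !inE eqxx !orbT andbT.
Qed.

Lemma phase_rate_flat m i n : rate_within m n i n =
  if i == m then 0 else if (m < i)%N then alpha m (i - m) 0 else 0.
Proof. by rewrite /phase_rate subrr !inE !andbT. Qed.

Lemma phase_rate_down m i n : rate_within m n.+1 i n =
  if i == m then mu m else if (m < i)%N then alpha m (i - m) (-1) else 0.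
Proof.
rewrite /phase_rate (_ : _ - _ = -1); last lia.
by rewrite !inE eqxx !andbT.
Qed.

Lemma phase_rate_far m i n l : l != n -> l != n.+1 -> n != l.+1 ->
  rate_within m n i l = 0.
Proof.
move=> ln lSn nSl; rewrite /phase_rate !inE.
set D := _ - _; have D0 : (D == 0) = false by lia.
have [D1 D2] : (D == 1) = false /\ (D == -1) = false by lia.
by rewrite D0 D1 D2 andbF; case: ifP.
Qed.

(** Sums over the neighbours of a state above the base level, in either
    direction of the jump: they lie in three consecutive levels. The value of
    [g] on the diagonal must vanish, as the excluded state is put back into the
    sum in order to get a rectangular range. *)
Lemma esum_neighbors (m : 'I_M.+1) n (G : state N M j0 -> R) (g : nat -> nat -> R) :
  (forall y, y != phase_state m n.+1 -> 0 <= G y) ->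
  (forall k, G (in_N k) = 0) ->
  (forall (i : 'I_M.+1) l, phase_state i l != phase_state m n.+1 ->
    G (phase_state i l) = g i l) ->
  (forall i l, l != n -> l != n.+1 -> l != n.+2 -> g i l = 0) ->
  g m n.+1 = 0 ->
  (\esum_(y in [set y | y != phase_state m n.+1]) (G y)%:E =
   (\sum_(i < M.+1) (g i n + g i n.+1 + g i n.+2))%:E)%E.
Proof.
move=> G0 GN Gg far diag; pose x := phase_state m n.+1.
pose G' y := if y == x then 0 else G y.
rewrite (eq_esum (b := fun y => (G' y)%:E)); last first.
  by move=> y /= yx; rewrite /G' (negbTE yx).
have G'E (i : 'I_M.+1) l : G' (phase_state i l) = g i l.
  rewrite /G'; case: eqP => [/(@phase_state_inj (i, l) (m, n.+1))[-> ->]//|/eqP /Gg//].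
pose s := [seq phase_state i l | i <- enum 'I_M.+1, l <- [:: n; n.+1; n.+2]].
rewrite (@esum_support _ _ _ _ s); first last.
- by move=> y _ /= /negP; rewrite negbK /G' => ->.
- move=> [k|[i j]] /=.
    by move=> _ _; exact: GN.
  move=> _; rewrite (level_atE j); move: (val j - j0)%N => l.
  rewrite -[inr _]/(phase_state i l) G'E => nots; apply: far;
    apply: contraNneq nots => ->;
    by apply: allpairs_f; rewrite ?mem_enum// !inE eqxx ?orbT.
- by move=> y /= yx; rewrite /G' (negbTE yx); exact: G0.
- apply: allpairs_uniq; rewrite ?enum_uniq//= ?inE; first lia.
  by move=> [i l] [i' l'] _ _ /(@phase_state_inj (i, l) (i', l')).
congr EFin; rewrite big_allpairs_dep/= big_enum/=.
by apply: eq_bigr => i _; rewrite !big_cons big_nil !G'E addr0 addrA.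
Qed.

Lemma exit_rate_upper (m : 'I_M.+1) n :
  exit_rate q (phase_state m n.+1) = (lambda m + mu m + alpha_tot M alpha m)%:E.
Proof.
rewrite /exit_rate (@esum_neighbors m n _ (fun i l => rate_within m n.+1 i l)).
- congr EFin.
  pose h i := rate_within m n.+1 i n + rate_within m n.+1 i n.+1
    + rate_within m n.+1 i n.+2.
  rewrite -(big_mkord xpredT h) (big_cat_nat (n := m))//=; last exact: ltnW.
  rewrite big_nat big1 ?add0r => [|i /andP[_ im]]; last first.
    rewrite /h phase_rate_down phase_rate_flat phase_rate_up ltnNge (ltnW im).
    by rewrite (ltn_eqF im) !addr0.
  rewrite big_ltn// {1}/h phase_rate_down phase_rate_flat phase_rate_up eqxx addr0.
  rewrite [mu m + _]addrC; congr (_ + _); rewrite /alpha_tot !big_nat.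
  apply: eq_bigr => i /andP[mi _]; rewrite /h phase_rate_down phase_rate_flat.
  by rewrite phase_rate_up (gtn_eqF mi) mi !big_cons big_nil addr0 addrA.
- by move=> y yx; apply: (classM_rate_ge0 hM); rewrite eq_sym.
- by move=> k; exact: phase_state_leave.
- by move=> i l; rewrite eq_sym; exact: phase_state_within.
- by move=> i l a b c; apply: phase_rate_far => //; rewrite eq_sym.
- by rewrite phase_rate_flat eqxx.
Qed.

Lemma inflow_upper (m : 'I_M.+1) n (pi : state N M j0 -> R) :
  (forall x, 0 <= pi x) ->
  (\esum_(y in [set y | y != phase_state m n.+1]) (pi y * q y (phase_state m n.+1))%:E =
  (lambda m * pi (phase_state m n) + mu m * pi (phase_state m n.+2) +
   \sum_(i < m) (alpha i (m - i)%N (-1) * pi (phase_state (inord i) n.+2) +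
                 alpha i (m - i)%N 0 * pi (phase_state (inord i) n.+1) +
                 alpha i (m - i)%N 1 * pi (phase_state (inord i) n)))%:E)%E.
Proof.
move=> pi0.
rewrite (@esum_neighbors m n _
  (fun i l => pi (phase_state (inord i) l) * rate_within i l m n.+1)).
- congr EFin.
  pose h i := pi (phase_state (inord i) n) * rate_within i n m n.+1
     + pi (phase_state (inord i) n.+1) * rate_within i n.+1 m n.+1
     + pi (phase_state (inord i) n.+2) * rate_within i n.+2 m n.+1.
  rewrite -(big_mkord xpredT h) (big_cat_nat (n := m.+1))//=.
  rewrite [X in _ + X]big_nat [X in _ + X]big1 ?addr0 => [|i /andP[im _]]; last first.
    rewrite /h phase_rate_down phase_rate_flat phase_rate_up ltnNge (ltnW im)/=.
    by rewrite (ltn_eqF im) !mulr0 !addr0.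
  rewrite big_nat_recr//= {2}/h phase_rate_down phase_rate_flat phase_rate_up eqxx.
  rewrite inord_val mulr0 addr0 addrC [pi _ * lambda _]mulrC [pi _ * mu _]mulrC.
  congr (_ + _); rewrite big_mkord; apply: eq_bigr => i _.
  rewrite /h phase_rate_down phase_rate_flat phase_rate_up ltn_ord gtn_eqF//.
  by ring.
- by move=> y yx; rewrite mulr_ge0//; exact: (classM_rate_ge0 hM).
- by move=> k; rewrite phase_state_enter mulr0.
- by move=> i l /phase_state_within ->; rewrite inord_val.
- by move=> i l a b c; rewrite phase_rate_far ?mulr0// eq_sym.
- by rewrite phase_rate_flat eqxx mulr0.
Qed.

Lemma exit_rate_boundary_lty x : (forall m n, x <> phase_state m n.+1) ->
  (exit_rate q x < +oo)%E.
Proof.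
move=> bx; pose s : seq (state N M j0) := [seq in_N k | k <- enum N] ++
  [seq phase_state i l | i <- enum 'I_M.+1, l <- [:: 0%N; 1%N]].
rewrite /exit_rate (@esum_support _ _ _ _ [seq y <- undup s | y != x]) ?ltry//.
- by rewrite filter_uniq// undup_uniq.
- by move=> y /= yx; apply: (classM_rate_ge0 hM); rewrite eq_sym.
- move=> y /= yx; rewrite mem_filter yx mem_undup mem_cat negb_or => /andP[].
  case: y yx => [k|[i j]] yx; first by rewrite map_f// mem_enum.
  move=> _; rewrite (level_atE j) in yx *; move: (val j - j0)%N yx => [|[|l]] yx.
  + by case/negP; apply: (allpairs_f phase_state); rewrite ?mem_enum.
  + by case/negP; apply: (allpairs_f phase_state); rewrite ?mem_enum.
  move=> _; case: x bx yx => [k|[m jm]] bx yx; first exact: phase_state_enter.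
  rewrite (level_atE jm) in bx yx *; move: (val jm - j0)%N bx yx => [|n] bx yx.
    have := @phase_state_within m i 0 l.+2; rewrite /phase_state /in_R eq_sym => ->//.
    by rewrite phase_rate_far.
  by have := bx m n.
- by move=> y; rewrite mem_filter => /andP[].
Qed.

(** Above the base level the exit rate does not depend on the level, so only
    finitely many values occur. *)
Lemma exit_rate_bounded : exists K : R, forall x, (exit_rate q x <= K%:E)%E.
Proof.
have exit_rate0 x : (0 <= exit_rate q x)%E.
  by apply: esum_ge0 => y /= yx; rewrite lee_fin (classM_rate_ge0 hM)// eq_sym.
(* [inr (m, false)] stands for phase [m] at the base level, [inr (m, true)] for
   phase [m] at any higher level. *)
pose e (c : N + 'I_M.+1 * bool) : \bar R :=
  match c with
  | inl k => exit_rate q (in_N k)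
  | inr (m, b) => exit_rate q (phase_state m b)
  end.
have e_fin c : e c \is a fin_num.
  case: c => [k|[m []]]; rewrite /e ?exit_rate_upper//.
    by rewrite ge0_fin_numE//; exact: exit_rate_boundary_lty.
  rewrite ge0_fin_numE//; apply: exit_rate_boundary_lty => i n.
  by move=> /(@phase_state_inj (m, 0%N) (i, n.+1)).
have e_le c : (e c <= (\sum_c fine (e c))%:E)%E.
  rewrite (bigD1 c)//= EFinD fineK// leeDl// lee_fin sumr_ge0// => c' _.
  by rewrite fine_ge0// /e; case: c' => [k|[m b]]; exact: exit_rate0.
exists (\sum_c fine (e c)) => -[k|[m j]]; first exact: (e_le (inl k)).
rewrite (level_atE j); case: (val j - j0)%N => [|n]; first exact: (e_le (inr (m, false))).
by have := e_le (inr (m, true)); rewrite /e !exit_rate_upper.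
Qed.

End class_M_balance.

(** * Recurrences driven by negative binomial weights *)

(** For [n >= 1], the coefficient of [z^n] in [r z / (1 - r z)^(k + 1)]: a
    negative binomial weight up to normalization. The predecessor is truncated,
    so that at [n = 0] the value is 1 for [k = 0] and 0 for larger [k]. *)
Definition negbin {R : pzSemiRingType} (r : R) (k n : nat) : R :=
  'C((n + k).-1, k)%:R * r ^+ n.

Section particular_solution.
Context {R : fieldType}.
Implicit Types (r : R) (a c : nat -> R).

Definition negbin_comb r m a n : R := \sum_(k < m) a k * negbin r k n.

Lemma negbin0n r n : negbin r 0 n = r ^+ n.
Proof. by rewrite /negbin bin0 mul1r. Qed.

(** Pascal's rule. *)
Lemma negbinSS r k n :
  negbin r k.+1 n.+1 = r * negbin r k.+1 n + negbin r k n.+1.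
Proof.
by rewrite /negbin addSn addnS/= binS natrD exprS; ring.
Qed.

(** Applying [E - r], with [E] the shift of the level, lowers the index [k] by
    one: the term [k = 0] is a pure power of [r] and disappears. *)
Lemma negbin_combS r m a n :
  negbin_comb r m.+1 a n.+1 = r * negbin_comb r m.+1 a n +
    negbin_comb r m (fun k => a k.+1) n.+1.
Proof.
rewrite /negbin_comb !big_ord_recl/= !negbin0n mulrDr exprS mulrCA -addrA.
congr (_ + _).
rewrite mulr_sumr -big_split; apply: eq_bigr => k _ /=.
by rewrite negbinSS mulrDr mulrCA.
Qed.

Lemma negbin_comb_widen r m a n : a m = 0 ->
  negbin_comb r m.+1 a n = negbin_comb r m a n.
Proof. by move=> am0; rewrite /negbin_comb big_ord_recr/= am0 mul0r addr0. Qed.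

(** Going back one level amounts to replacing the coefficients [a k] by
    [(a k - a k.+1) / r]; this allows all the terms of the recurrence to be
    written at the same level, without partial sums of coefficients. *)
Lemma negbin_comb_back r m a n : a m = 0 ->
  r * negbin_comb r m a n = negbin_comb r m (fun k => a k - a k.+1) n.+1.
Proof.
move=> am0; have := negbin_combS r m a n; rewrite !negbin_comb_widen// => /eqP.
rewrite -subr_eq => /eqP <-; rewrite /negbin_comb -sumrB.
by apply: eq_bigr => k _; rewrite mulrBl.
Qed.

(** The hypothesis on [c] is the coefficient formula, with [bm], [b0] and [bp]
    the coefficients of the inhomogeneous terms at the next, the same and the
    previous level. The geometric sum over [u] in it solves the first-order
    relation between [c k] and [c k.+1] obtained by bringing the recurrence to
    the highest level and comparing coefficients. *)
Lemma particular_solution r phi la mu w m (bm b0 bp c : nat -> R) :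
  r != 0 -> la != 0 -> w != 0 -> mu * r = la * phi -> w = 1 - r * phi ->
  (forall k, (m <= k)%N -> bm k = 0 /\ b0 k = 0 /\ bp k = 0) ->
  (forall k, (0 < k)%N -> c k =
     r / (la * w) * r *
       (\sum_(k <= u < m) (bm u + b0 u * phi + bp u * phi ^+ 2) / w ^+ (u + 1 - k))
     - la^-1 * bp k
     + r / (la * w) * (bm k.-1 * r + b0 k.-1 + bp k.-1 / r)) ->
  forall n,
  (mu * r + la / r) * negbin_comb r m.+1 c n.+1 =
  la * negbin_comb r m.+1 c n + mu * negbin_comb r m.+1 c n.+2
  + (negbin_comb r m bm n.+2 + negbin_comb r m b0 n.+1 + negbin_comb r m bp n).
Proof.
move=> r0 la0 w0 mur wE b_0 cE n.
have tailE k :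
  (\sum_(k <= u < m) (bm u + b0 u * phi + bp u * phi ^+ 2) / w ^+ (u + 1 - k)) =
  (\sum_(k.+1 <= u < m) (bm u + b0 u * phi + bp u * phi ^+ 2) / w ^+ (u + 1 - k.+1)) / w
  + (bm k + b0 k * phi + bp k * phi ^+ 2) / w.
  have [ltkm|lemk] := ltnP k m; last first.
    have [-> [-> ->]] := b_0 k lemk.
    by rewrite !big_geq ?(leqW lemk)// !(mul0r, addr0).
  rewrite big_ltn// addrC addn1 subSnn expr1; congr (_ + _).
  rewrite mulr_suml !big_seq; apply: eq_bigr => u.
  rewrite mem_index_iota => /andP[ku _].
  by rewrite -mulrA -invfM -exprSr !addn1 subSS subSn// ltnW.
(* The formula for [c k], minus [1 / w] times the one for [c k.+1]. *)
have c_step k : (0 < k)%N -> c k = c k.+1 / w + r / (la * w) *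
    (r * bm k.-1 + (b0 k.-1 - b0 k) + (bp k.-1 - bp k *+ 2 + bp k.+1) / r).
  move=> k0; rewrite !cE// tailE /=.
  set S := \sum_(_ <= _ < _) _; move: w0; rewrite wE => w0.
  by field; rewrite r0 la0 w0.
have cS0 : c m.+1 = 0.
  rewrite cE// big_geq//=; have [_ [_ ->]] := b_0 m.+1 (leqnSn m).
  have [-> [-> ->]] := b_0 m (leqnn m); ring.
have [bm0 [b00 bp0]] := b_0 m (leqnn m).
have [_ [b01 bp1]] := b_0 m.+1 (leqnSn m).
rewrite !negbin_combS.
set y := negbin_comb r m.+1 c n; set c1 := fun k => c k.+1.
suff : la / r * negbin_comb r m c1 n.+1 - mu * negbin_comb r m c1 n.+2 =
    negbin_comb r m bm n.+2 + negbin_comb r m b0 n.+1 + negbin_comb r m bp n.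
  by move=> <-; field.
(* Bring all the terms to the level [n.+2]; [bp] has to be moved twice. *)
rewrite -[negbin_comb r m c1 n.+1](mulKf r0) negbin_comb_back//
  -[negbin_comb r m b0 _](mulKf r0) negbin_comb_back//.
rewrite -[negbin_comb r m bp _](mulKf r0) negbin_comb_back//
  -[negbin_comb r m _ n.+1](mulKf r0) negbin_comb_back; last first.
  by rewrite bp0 bp1 subr0.
rewrite /negbin_comb !mulr_sumr -sumrB -!big_split/=; apply: eq_bigr => k _.
rewrite /c1 (c_step k.+1)//=.
have -> : mu = la * phi / r by rewrite -mur mulfK.
by move: w0; rewrite wE => w0; field; rewrite r0 la0 w0.
Qed.

End particular_solution.

Section decay.
Context {R : realType}.
Implicit Types (r phi la mu : R) (d y : R ^nat).

(** By Pascal's rule, [z n.+1 <= r z n + C t^n.+1] with [z] the next weight;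
    as [r < t] the solution stays below a multiple of [t^n]. *)
Lemma negbin_le_geometric r t k : 0 < r -> r < t ->
  exists2 C, 0 <= C & forall n, negbin r k n <= C * t ^+ n.
Proof.
move=> r0 rt; have t0 : 0 < t by exact: lt_trans rt.
elim: k => [|k [C C0 IH]].
  by exists 1 => // n; rewrite negbin0n mul1r lerXn2r ?nnegrE ?ltW.
have tr0 : 0 < t - r by rewrite subr_gt0.
(* The constant for which the induction step is an equality. *)
exists (C * t / (t - r)); first by rewrite divr_ge0 ?mulr_ge0// ltW.
elim=> [|n IHn].
  by rewrite /negbin add0n/= bin_small// mul0r !mulr_ge0 ?invr_ge0// ltW.
rewrite negbinSS; apply: (le_trans (lerD (ler_wpM2l (ltW r0) IHn) (IH n.+1))).
by rewrite exprS le_eqVlt; apply/orP; left; apply/eqP; field; rewrite gt_eqF.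
Qed.

Lemma cvg_negbin r k : 0 < r -> r < 1 -> negbin r k n @[n --> \oo] --> 0.
Proof.
move=> r0 r1; pose t := (r + 1) / 2; have [rt t1] := midf_lt r1.
have [C C0 le_geo] := negbin_le_geometric k r0 rt.
apply: (@squeeze_cvgr _ _ _ _ (fun=> 0) (fun n => C * t ^+ n)).
- apply: nearW => n; rewrite le_geo andbT /negbin mulr_ge0//.
  by rewrite exprn_ge0// ltW.
- exact: cvg_cst.
- rewrite -[X in _ --> X](mulr0 C); apply: cvgM; first exact: cvg_cst.
  by apply: cvg_expr; rewrite ger0_norm// ltW// (lt_trans r0).
Qed.

Lemma cvg_negbin_comb r m a : 0 < r -> r < 1 ->
  negbin_comb r m a n @[n --> \oo] --> 0.
Proof.
move=> r0 r1; rewrite [X in _ --> X](_ : 0 = \sum_(k < m) a k * 0).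
  apply: cvg_big => [|k _]; first exact: add_continuous.
  by apply: cvgM; [exact: cvg_cst|exact: cvg_negbin].
by rewrite big1// => k _; rewrite mulr0.
Qed.

Lemma cvg_shift_sub y c : y n @[n --> \oo] --> 0 ->
  y n.+1 - c * y n @[n --> \oo] --> 0.
Proof.
move=> y0; rewrite -[X in _ --> X](subrr 0) -[X in _ - X](mulr0 c).
apply: cvgB; first by rewrite (cvg_shiftS y).
by apply: cvgM => //; exact: cvg_cst.
Qed.

(** The difference [d n.+1 - r d n] is multiplied by [1 / phi >= 1] at each
    step, so it can only decay by being zero; then [d n] is [d 0] times [r^n]. *)
Lemma decaying_solution0 r phi la mu d : 0 < r -> 0 < la -> 0 < phi <= 1 ->
  mu * r = la * phi ->
  (forall n, (mu * r + la / r) * d n.+1 = la * d n + mu * d n.+2) ->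
  d n @[n --> \oo] --> 0 -> d 0%N = 0 -> forall n, d n = 0.
Proof.
move=> r0 la0 /andP[phi0 phi1] mur rec_d cvg_d d0.
pose e n := d n.+1 - r * d n.
have muE : mu = la / r * phi by rewrite mulrAC -mur mulfK ?gt_eqF.
have eS n : e n = phi * e n.+1.
  apply: (@mulfI _ (la / r)); first by rewrite gt_eqF// divr_gt0.
  rewrite mulrA -muE; apply/eqP; rewrite -subr_eq0; apply/eqP.
  have /eqP := rec_d n; rewrite -subr_eq0 => /eqP <-; rewrite /e.
  by field; rewrite gt_eqF.
have e_cvg : `|e n| @[n --> \oo] --> 0.
  by rewrite -[X in _ --> X](@normr0 _ R); apply: cvg_norm; exact: cvg_shift_sub.
have e_nd : nondecreasing_seq (fun n => `|e n|).
  apply/nondecreasing_seqP => n; rewrite [X in `|X| <= _]eS normrM.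
  by rewrite gtr0_norm// ler_piMl.
have e0 n : e n = 0.
  apply/eqP; rewrite -normr_le0.
  have := nondecreasing_cvgn_le e_nd (cvgP _ e_cvg) n.
  by rewrite (cvg_lim _ e_cvg).
elim=> // n IH; apply/eqP.
by have /eqP := e0 n; rewrite /e IH mulr0 subr0.
Qed.

(** The net flow [mu y n.+1 - la y n] between consecutive levels is
    nonincreasing with limit zero, hence nonnegative; with [mu <= la] this makes
    [y] nondecreasing. *)
Lemma decaying_supersolution0 la mu y : 0 < mu -> mu <= la ->
  (forall n, 0 <= y n) -> y n @[n --> \oo] --> 0 ->
  (forall n, la * y n + mu * y n.+2 <= (la + mu) * y n.+1) ->
  forall n, y n = 0.
Proof.
move=> mu0 mula y0 cvg_y le_y; have la0 : 0 < la by exact: lt_le_trans mula.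
pose D n := y n.+1 - la / mu * y n.
have D_ni : nonincreasing_seq D.
  apply/nonincreasing_seqP => n; rewrite -(ler_pM2l mu0) /D.
  have := le_y n; rewrite !mulrBr !mulrA [mu * la]mulrC !mulfK ?gt_eqF//.
  lra.
have cvg_D : D n @[n --> \oo] --> 0 by exact: cvg_shift_sub.
have D0 n : 0 <= D n.
  have := nonincreasing_cvgn_ge D_ni (cvgP _ cvg_D) n.
  by rewrite (cvg_lim _ cvg_D).
have y_nd : nondecreasing_seq y.
  apply/nondecreasing_seqP => n; have := D0 n; rewrite /D subr_ge0; apply: le_trans.
  by rewrite ler_peMl// ler_pdivlMr// mul1r.
move=> n; apply/eqP; rewrite eq_le y0 andbT.
by have := nondecreasing_cvgn_le y_nd (cvgP _ cvg_y) n; rewrite (cvg_lim _ cvg_y).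
Qed.

End decay.

(** * The triangular system for the coefficients *)

Lemma course_of_values (A : Type) (a0 : A) (F : (nat -> A) -> nat -> A) :
  (forall f g m, (forall i, (i < m)%N -> f i = g i) -> F f m = F g m) ->
  exists f, forall m, f m = F f m.
Proof.
move=> Floc; pose tab := fix tab n : nat -> A :=
  if n is n'.+1 then fun i => if i == n' then F (tab n') n' else tab n' i
  else fun=> a0.
have tabE n i : (i < n)%N -> tab n i = tab i.+1 i.
  elim: n => //= n IH; rewrite ltnS leq_eqVlt => /predU1P[->|lt_in].
    by rewrite /= eqxx.
  by rewrite (ltn_eqF lt_in) IH.
exists (fun i => tab i.+1 i) => m; rewrite /= eqxx.
by apply: Floc => i; exact: tabE.
Qed.

Section coefficients.
Context {R : fieldType}.
Implicit Types (r : R) (la ph Om : nat -> R) (alpha : nat -> nat -> int -> R)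
  (c : nat -> nat -> R).

(** One formula for all [k >= 1]: on the diagonal [k = m] its first two sums are
    empty and the last one is reduced to [i = m - 1]. *)
Definition coef_step r la ph Om alpha c m k : R :=
  Om m * r *
    (\sum_(k <= u < m) \sum_(u <= i < m)
       c i u *
       (\sum_(D <- level_steps)
          alpha i (m - i)%N D * ph m ^ (D + 1)
          / (1 - r * ph m) ^+ (u + 1 - k)))
  - (la m)^-1 * (\sum_(k <= i < m) c i k * alpha i (m - i)%N 1)
  + Om m *
    (\sum_(k.-1 <= i < m)
       c i k.-1 *
       (\sum_(D <- level_steps) alpha i (m - i)%N D * r ^ (- D))).

Lemma coef_step_local r la ph Om alpha c c' m k :
  (forall i, (i < m)%N -> c i = c' i) ->
  coef_step r la ph Om alpha c m k = coef_step r la ph Om alpha c' m k.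
Proof.
move=> cc'; have sum_c a (H : nat -> R) v : \sum_(a <= i < m) c i v * H i =
    \sum_(a <= i < m) c' i v * H i.
  by apply: eq_big_nat => i /andP[_ im]; rewrite cc'.
rewrite /coef_step !sum_c; congr (_ * _ - _ + _).
by apply: eq_bigr => u _; rewrite sum_c.
Qed.

(** All the ranges are empty; the coefficients above the diagonal vanish without
    a case distinction in their definition. *)
Lemma coef_step_gt r la ph Om alpha c m k : (m < k)%N ->
  coef_step r la ph Om alpha c m k = 0.
Proof.
case: k => // k mk; rewrite /coef_step/= !big_geq ?leqW//.
by rewrite !mulr0 subrr addr0.
Qed.

Lemma negbin_comb_widen_le r a m (f : nat -> R) n : (a <= m)%N ->
  (forall k, (a <= k)%N -> f k = 0) -> negbin_comb r m f n = negbin_comb r a f n.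
Proof.
move=> am f0; rewrite /negbin_comb -!(big_mkord xpredT (fun k => f k * negbin r k n)).
rewrite (big_cat_nat (leq0n _) am)//= [X in _ + X]big_nat.
rewrite [X in _ + X]big1 ?addr0// => k /andP[ak _].
by rewrite f0// mul0r.
Qed.

(** Vanishing above the diagonal lets the triangular sums over [i] run over all
    the lower phases; their inner sums are then the coefficients of the
    inhomogeneous terms required by [particular_solution]. *)
Lemma coef_step_solution r la mu ph Om alpha c m :
  r != 0 -> la m != 0 -> 1 - r * ph m != 0 -> ph m != 0 ->
  mu * r = la m * ph m -> Om m = r / (la m * (1 - r * ph m)) ->
  (forall i k, (i < k)%N -> c i k = 0) ->
  (forall k, (0 < k)%N -> c m k = coef_step r la ph Om alpha c m k) ->
  forall n,
  (mu * r + la m / r) * negbin_comb r m.+1 (c m) n.+1 =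
  la m * negbin_comb r m.+1 (c m) n + mu * negbin_comb r m.+1 (c m) n.+2
  + \sum_(i < m) (alpha i (m - i)%N (-1) * negbin_comb r i.+1 (c i) n.+2
                + alpha i (m - i)%N 0 * negbin_comb r i.+1 (c i) n.+1
                + alpha i (m - i)%N 1 * negbin_comb r i.+1 (c i) n).
Proof.
move=> r0 la0 w0 ph0 mur OmE c0 cE n.
pose b D k := \sum_(i < m) c i k * alpha i (m - i)%N D.
have combE D l : negbin_comb r m (b D) l =
    \sum_(i < m) alpha i (m - i)%N D * negbin_comb r i.+1 (c i) l.
  rewrite /negbin_comb; under eq_bigr do rewrite mulr_suml.
  rewrite exchange_big/=; apply: eq_bigr => i _.
  rewrite -/(negbin_comb r i.+1 (c i) l) -(@negbin_comb_widen_le _ _ m)//; last exact: c0.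
  by rewrite /negbin_comb mulr_sumr; apply: eq_bigr => k _; rewrite [RHS]mulrCA mulrA.
have sum_c u (H : nat -> R) :
    \sum_(u <= i < m) c i u * H i = \sum_(i < m) c i u * H i.
  rewrite -(big_mkord xpredT (fun i => c i u * H i)).
  have [um|mu'] := leqP u m; last first.
    rewrite [LHS]big_geq ?(ltnW mu')// big_nat big1// => i /andP[_ im].
    by rewrite c0 ?mul0r// (ltn_trans im).
  rewrite (big_cat_nat (leq0n _) um)//= [X in X + _]big_nat.
  rewrite [X in X + _]big1 ?add0r// => i /andP[_ iu].
  by rewrite c0 ?mul0r.
rewrite !big_split/= -!combE.
apply: (@particular_solution _ r (ph m) (la m) mu (1 - r * ph m)) => //.
  move=> k mk; rewrite /b; split; [|split]; apply: big1 => i _;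
    by rewrite c0 ?mul0r// (leq_trans (ltn_ord i)).
move=> k k0; rewrite cE// /coef_step OmE; congr (_ * _ - _ + _ * _).
- apply: eq_big_nat => u _; rewrite sum_c /b !mulr_suml -!big_split/= mulr_suml.
  apply: eq_bigr => i _; rewrite !big_cons big_nil.
  rewrite addNr add0r expr0z expr1z (_ : 1 + 1 = 2%:Z)// -exprnP.
  by ring.
- by rewrite sum_c.
- rewrite sum_c /b !mulr_suml -!big_split/=; apply: eq_bigr => i _.
  rewrite !big_cons big_nil opprK oppr0 expr0z expr1z exprN1.
  by field.
Qed.

End coefficients.

(** * The roots of the recurrence of a phase *)

Section phi_properties.
Context {R : realType}.
Context (lambda mu : nat -> R) (m : nat) (s : R).
Context (la0 : 0 < lambda m) (mu0 : 0 < mu m) (s0 : 0 <= s).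

Let b := s + lambda m + mu m.
Let D := b ^+ 2 - 4 * lambda m * mu m.

Lemma phi_root :
  lambda m * phi lambda mu m s ^+ 2 - b * phi lambda mu m s + mu m = 0.
Proof.
have D0 : 0 <= D.
  rewrite (_ : D = (lambda m - mu m) ^+ 2 + s * (s + 2 * (lambda m + mu m))).
    by rewrite addr_ge0 ?sqr_ge0// mulr_ge0// addr_ge0// mulr_ge0// addr_ge0// ltW.
  by rewrite /D /b; ring.
have sq := sqr_sqrtr D0; rewrite /phi -/b -/D.
have -> : mu m = (b ^+ 2 - Num.sqrt D ^+ 2) / (4 * lambda m).
  by rewrite sq /D; field; rewrite gt_eqF.
by field; rewrite gt_eqF.
Qed.

Lemma phi_gt0_le1 : 0 < phi lambda mu m s <= 1.
Proof.
have b0 : 0 < b by rewrite /b addr_gt0// ltr_wpDl.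
have Db : Num.sqrt D < b.
  rewrite -[ltRHS]gtr0_norm// -sqrtr_sqr ltr_sqrt ?exprn_gt0// /D ltrBlDr ltrDl.
  by rewrite !mulr_gt0.
have bD : b - 2 * lambda m <= Num.sqrt D.
  apply: le_trans (ler_norm _) _; rewrite -sqrtr_sqr ler_wsqrtr//.
  rewrite -subr_ge0 (_ : D - (b - 2 * lambda m) ^+ 2 = 4 * (lambda m * s)).
    by rewrite !mulr_ge0// ltW.
  by rewrite /D /b; ring.
rewrite /phi -/b -/D divr_gt0 ?subr_gt0 ?mulr_gt0//=.
by rewrite ler_pdivrMr ?mulr_gt0// mul1r lerBlDr -lerBlDl.
Qed.

End phi_properties.

Section phase_constants.
Context {R : realType} (M : nat).
Context (lambda mu : nat -> R) (alpha : nat -> nat -> int -> R) (m : nat).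
Context (la0 : 0 < lambda m) (mu0 : 0 < mu m) (al0 : 0 <= alpha_tot M alpha m).

Let r := rbase M lambda mu alpha m.
Let ph := phia M lambda mu alpha m.

Lemma phia_gt0_le1 : 0 < ph <= 1.
Proof. exact: phi_gt0_le1. Qed.

Lemma rbase_gt0 : 0 < r.
Proof. by have /andP[ph0 _] := phia_gt0_le1; rewrite mulr_gt0// divr_gt0. Qed.

Lemma rbase_phia : mu m * r = lambda m * ph.
Proof. by rewrite /r /rbase -/ph; field; rewrite gt_eqF. Qed.

(** Vieta: [mu r = la phi] and [la / r = mu / phi], and [phi] is a root of
    [la z^2 - (la + mu + alpha) z + mu]. *)
Lemma total_rateE :
  mu m * r + lambda m / r = lambda m + mu m + alpha_tot M alpha m.
Proof.
have /andP[ph0 _] := phia_gt0_le1.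
have := phi_root la0 mu0 al0; rewrite -/(phia M lambda mu alpha m) -/ph => root.
have muE : mu m = (alpha_tot M alpha m + lambda m + mu m) * ph - lambda m * ph ^+ 2.
  lra.
rewrite rbase_phia /r /rbase -/ph; apply: (@mulIf _ ph); first by rewrite gt_eqF.
transitivity (lambda m * ph ^+ 2 + mu m); last by rewrite {1}muE; ring.
by field; rewrite !gt_eqF.
Qed.

End phase_constants.

(** * Limiting probabilities of the phases *)

Section class_M_limit.
Context {R : realType} {N : finType} {M j0 : nat}.
Context (lambda mu : nat -> R) (alpha : nat -> nat -> int -> R).
Context (q : state N M j0 -> state N M j0 -> R).
Context {d : measure_display} {W : measurableType d}.
Context (P : state N M j0 -> probability W R) (X : R -> W -> state N M j0).
Context (pi : state N M j0 -> R).
Context (hM : classM lambda mu alpha q) (hX : is_ctmc P X q).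
Context (hpi : limiting_distribution P X pi).

Definition phase_prob m n : R := pi (phase_state (inord m) n).

Lemma class_M_balance x : balance_at q pi x.
Proof. by have [K /(limiting_balance hX hpi)] := exit_rate_bounded hM. Qed.

Lemma phase_prob_ge0 m n : 0 <= phase_prob m n.
Proof. by have [[pi0 _] _] := hpi; exact: pi0. Qed.

Lemma cvg_phase_prob m : phase_prob m n @[n --> \oo] --> 0.
Proof.
have [[pi0 pi1] _] := hpi.
apply: (@summable_cvg0 _ _ pi (fun n => phase_state (inord m) n)) => //.
  by move=> n n' [/addnI].
by rewrite pi1 ltry.
Qed.

Lemma phase_recurrence m n : (m <= M)%N ->
  (lambda m + mu m + alpha_tot M alpha m) * phase_prob m n.+1 =
  lambda m * phase_prob m n + mu m * phase_prob m n.+2 +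
  \sum_(i < m) (alpha i (m - i)%N (-1) * phase_prob i n.+2
              + alpha i (m - i)%N 0 * phase_prob i n.+1
              + alpha i (m - i)%N 1 * phase_prob i n).
Proof.
move=> mM; have [[pi0 _] _] := hpi.
have := class_M_balance (phase_state (inord m) n.+1).
rewrite /balance_at (exit_rate_upper hM) (inflow_upper hM)// inordK// -EFinM => -[].
by rewrite mulrC.
Qed.

Lemma alpha_tot_ge0 m : 0 <= alpha_tot M alpha m.
Proof.
rewrite /alpha_tot big_nat; apply: sumr_ge0 => i mi.
by rewrite big_seq; apply: sumr_ge0 => D; exact: (classM_alpha_ge0 hM).
Qed.

(** The top phase has [alpha = 0]. If [la < mu] then [r <= la / mu < 1] because
    [phi <= 1]. If [mu <= la], the inflow from the lower phases makes the
    probabilities of the top phase a decaying supersolution, hence zero, against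
    their positivity. *)
Lemma rbase_top_lt1 : 0 < lambda M -> 0 < mu M -> irreducible P X ->
  rbase M lambda mu alpha M < 1.
Proof.
move=> la0 mu0 irr; have al0 := alpha_tot_ge0 M.
have /andP[ph0 ph1] := phia_gt0_le1 la0 mu0 al0.
have [lamu|mula] := ltP (lambda M) (mu M).
  have : lambda M / mu M < 1 by rewrite ltr_pdivrMr// mul1r.
  by apply: le_lt_trans; rewrite ler_piMr// divr_ge0 ?ltW.
have y0 : forall n, phase_prob M n = 0.
  apply: (decaying_supersolution0 mu0 mula) => [n||n].
  - exact: phase_prob_ge0.
  - exact: cvg_phase_prob.
  have := phase_recurrence n (leqnn M).
  rewrite {1}/alpha_tot big_geq// addr0 => ->; rewrite lerDl.
  apply: sumr_ge0 => i _.
  have a0 D : D \in level_steps -> 0 <= alpha i (M - i)%N D.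
    by apply: (classM_alpha_ge0 hM); rewrite ltn_ord leqnn.
  by rewrite !addr_ge0// mulr_ge0 ?phase_prob_ge0// a0.
have := limiting_gt0 hX hpi irr (phase_state (inord M) 0).
by rewrite -/(phase_prob M 0) y0 ltxx.
Qed.

End class_M_limit.

Lemma level_binE j0 n k : level_bin j0 (j0 + n) k = 'C((n + k).-1, k).
Proof. by rewrite /level_bin; congr 'C(_, _); lia. Qed.

Theorem theorem4 (R : realType) (N : finType) (M j0 : nat)
  (lambda mu : nat -> R) (alpha : nat -> nat -> int -> R)
  (q : state N M j0 -> state N M j0 -> R)
  (d : measure_display) (W : measurableType d)
  (P : state N M j0 -> probability W R) (X : R -> W -> state N M j0)
  (pi : state N M j0 -> R)
  (hM : classM lambda mu alpha q)
  (hX : is_ctmc P X q)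
  (herg : ergodic P X)
  (hpi : limiting_distribution P X pi)
  (hlambda : forall m : nat, (m <= M)%N -> 0 < lambda m)
  (hmu : forall m : nat, (m <= M)%N -> 0 < mu m)
  (hr : forall m : nat, (m <= M)%N ->
     rbase M lambda mu alpha m = rbase M lambda mu alpha 0) :
  let r0 := rbase M lambda mu alpha 0 in
  let ph := phia M lambda mu alpha in
  let Om := Omega M lambda mu alpha in
  exists c : nat -> nat -> R,
    (forall (m : 'I_M.+1) (j : level j0),
       pi (in_R m j) =
       \sum_(0 <= k < m.+1)
          c m k * (level_bin j0 (val j) k)%:R * r0 ^+ (val j - j0)) /\
    (forall m : 'I_M.+1, c m 0%N = pi (in_R m (base_level j0))) /\
    (forall m k : nat, (m <= M)%N -> (1 <= k < m)%N ->
       c m k =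
         Om m * r0 *
           (\sum_(k <= u < m) \sum_(u <= i < m)
              c i u *
              (\sum_(D <- level_steps)
                 alpha i (m - i)%N D * ph m ^ (D + 1)
                 / (1 - r0 * ph m) ^+ (u + 1 - k)))
         - (lambda m)^-1 * (\sum_(k <= i < m) c i k * alpha i (m - i)%N 1)
         + Om m *
           (\sum_(k.-1 <= i < m)
              c i k.-1 *
              (\sum_(D <- level_steps) alpha i (m - i)%N D * r0 ^ (- D)))) /\
    (forall m : nat, (1 <= m <= M)%N ->
       c m m =
         c m.-1 m.-1 * Om m *
         (\sum_(D <- level_steps) alpha m.-1 1%N D * r0 ^ (- D))) /\
    (forall n : N, balance_at q pi (in_N n)) /\
    (forall m : 'I_M.+1, balance_at q pi (in_R m (base_level j0))) /\
    (\esum_(x in [set: state N M j0]) (pi x)%:E)%E = 1%E.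
Proof.
move=> r0 ph Om.
have al0 m := alpha_tot_ge0 hM m.
have ph01 m : (m <= M)%N -> 0 < ph m <= 1.
  by move=> mM; apply: phia_gt0_le1 => //; [exact: hlambda|exact: hmu].
have r_gt0 : 0 < r0 by apply: rbase_gt0 => //; [exact: hlambda|exact: hmu].
have r_lt1 : r0 < 1.
  rewrite /r0 -(hr _ (leqnn M)).
  apply: (rbase_top_lt1 hM hX hpi); [exact: hlambda|exact: hmu|by case: herg].
(* The common value of [r] carries the stability of the top phase to all the
   phases; in particular the denominators of [Om] do not vanish. *)
have w0 m : (m <= M)%N -> 1 - r0 * ph m != 0.
  move=> mM; have /andP[ph0 ph1] := ph01 m mM.
  rewrite subr_eq0 eq_sym lt_eqF//; apply: le_lt_trans r_lt1.
  by rewrite ler_piMr// ltW.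
pose x := phase_prob pi.
pose F (c : nat -> nat -> R) m k :=
  if k is 0%N then x m 0%N else coef_step r0 lambda ph Om alpha c m k.
have [c cE] : exists c, forall m, c m = F c m.
  apply: course_of_values => [|f g m fg]; first exact: (fun=> 0).
  by apply: funext => -[//|k]; exact: coef_step_local.
have c_step m k : (0 < k)%N -> c m k = coef_step r0 lambda ph Om alpha c m k.
  by case: k => // k _; rewrite {1}cE.
have c0 m : c m 0%N = x m 0%N by rewrite cE.
have c_gt m k : (m < k)%N -> c m k = 0.
  by move=> mk; rewrite c_step ?coef_step_gt//; exact: leq_trans mk.
have xE m n : (m <= M)%N -> x m n = negbin_comb r0 m.+1 (c m) n.
  elim/ltn_ind: m n => m IH n mM.
  have /andP[ph0 ph1] := ph01 m mM.
  have mur : mu m * r0 = lambda m * ph m.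
    by rewrite /r0 -(hr _ mM); apply: rbase_phia; exact: hmu.
  have total : mu m * r0 + lambda m / r0 = lambda m + mu m + alpha_tot M alpha m.
    by rewrite /r0 -(hr _ mM); apply: total_rateE; rewrite ?hlambda ?hmu.
  apply/eqP; rewrite -subr_eq0; apply/eqP; move: n.
  apply: (@decaying_solution0 _ r0 (ph m) (lambda m) (mu m)) => //.
  - exact: hlambda.
  - by rewrite ph0.
  - move=> n.
    have OmE : Om m = r0 / (lambda m * (1 - r0 * ph m)) by rewrite /Om /Omega hr.
    rewrite !mulrBr (coef_step_solution _ _ (w0 m mM) _ mur OmE c_gt (c_step m));
      rewrite ?gt_eqF ?hlambda//.
    under eq_bigr => i _ do rewrite -!IH ?(leq_trans (ltnW (ltn_ord i)))//.
    by rewrite total /x (phase_recurrence hM hX hpi)//; ring.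
  - rewrite -[X in _ --> X](subr0 0); apply: cvgB; first exact: (cvg_phase_prob hpi).
    exact: cvg_negbin_comb.
  - rewrite /negbin_comb big_ord_recl/= negbin0n mulr1 c0 big1 ?addr0 ?subrr// => k _.
    by rewrite /negbin add0n bin_small// mul0r mulr0.
exists c; split; [|split; [|split; [|split; [|split; [|split]]]]].
- move=> m j; rewrite (level_atE j) /= addKn.
  have := xE m (val j - j0)%N (ltn_ord m); rewrite /x /phase_prob inord_val => ->.
  rewrite /negbin_comb big_mkord; apply: eq_bigr => k _.
  by rewrite level_binE mulrA.
- by move=> m; rewrite c0 /x /phase_prob inord_val base_levelE.
- by move=> m k _ /andP[k0 _]; exact: c_step.
(* On the diagonal, two of the three sums of [coef_step] are empty. *)
- move=> m /andP[m0 _].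
  rewrite c_step// /coef_step !(big_geq (leqnn m)) !mulr0 subrr add0r.
  by case: m m0 => // m _; rewrite /= big_nat1 subSnn mulrA [Om _ * _]mulrC.
- by move=> n; exact: (class_M_balance hM hX hpi).
- by move=> m; exact: (class_M_balance hM hX hpi).
- by case: hpi => -[].
Qed.
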